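(* Let $\mathcal{C}$ be a category with a faithful functor $Q:\mathcal{C}\to Set$ satisfying the following condition for every two objects $A$ and $B$ of $\mathcal{C}$: if $Q(A)$ and $Q(B)$ have the same cardinality, then for every bijection $u:Q(A)\to Q(B)$ there exist a unique object $C$ of $\mathcal{C}$ and an isomorphism $u^*:C\to B$ such that $Q(C)=Q(A)$ and $Q(u^* )=u$. If the functor $Q$ is represented by an object $W$ of $\mathcal{C}$ and if an autoequivalence $\pi:\mathcal{C}\to\mathcal{C}$ satisfies the condition that $W$ is isomorphic to $\pi(W)$, then for every object $A$ of $\mathcal{C}$ there exists a bijection $u_A:Q(A)\to Q(\pi(A))$ such that $Q(\pi(f))\circ u_A=u_B\circ Q(f)$ for every morphism $f:A\to B$ of $\mathcal{C}$, and hence $\pi$ is isomorphic (as a functor) to an automorphism of $\mathcal{C}$.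
   Context: $Set$ is the category of all sets and maps. $Q$ is represented by $W$ if $Q$ is naturally isomorphic to $\mathrm{Hom}(W,-)$. An autoequivalence of $\mathcal{C}$ is a functor $\mathcal{C}\to\mathcal{C}$ that is full and faithful and such that every object of $\mathcal{C}$ is isomorphic to an object in its image. An automorphism of $\mathcal{C}$ is a functor $\mathcal{C}\to\mathcal{C}$ having a two-sided inverse functor (strictly). Two functors are isomorphic if there is a natural isomorphism between them. *)

(* Defs.v *)
From Stdlib Require Import FunctionalExtensionality.
From mathcomp Require Import ssreflect ssrfun ssrbool.

Set Implicit Arguments.
Unset Strict Implicit.
Unset Printing Implicit Defensive.

Declare Scope cat_scope.
Delimit Scope cat_scope with cat.
Local Open Scope cat_scope.

Record category := Category {
  ob :> Type;
  hom : ob -> ob -> Type;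
  idm : forall A, hom A A;
  comp : forall A B C, hom B C -> hom A B -> hom A C;
  comp1m : forall A B (f : hom A B), comp (idm B) f = f;
  compm1 : forall A B (f : hom A B), comp f (idm A) = f;
  compA : forall A B C D (h : hom C D) (g : hom B C) (f : hom A B),
    comp h (comp g f) = comp (comp h g) f
}.

Arguments idm {c} A.
Arguments comp {c A B C} g f.

Notation "g ∘ f" := (comp g f)
  (at level 40, left associativity) : cat_scope.

Definition isomorphism (C : category) (A B : C) (f : hom A B) : Prop :=
  exists g : hom B A, g ∘ f = idm A /\ f ∘ g = idm B.

Definition isomorphic (C : category) (A B : C) : Prop :=
  exists f : hom A B, isomorphism f.

Record functor (C D : category) := Functor {
  fobj :> C -> D;
  fmap : forall A B : C, hom A B -> hom (fobj A) (fobj B);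
  fmap1 : forall A : C, fmap (idm A) = idm (fobj A);
  fmapM : forall (X Y Z : C) (g : hom Y Z) (f : hom X Y),
    fmap (g ∘ f) = fmap g ∘ fmap f
}.

Arguments fmap {C D} F {A B} f : rename.

Definition id_functor (C : category) : functor C C :=
  @Functor C C (fun A => A) (fun _ _ f => f)
    (fun _ => erefl) (fun _ _ _ _ _ => erefl).

Lemma comp_functor_id (C D E : category) (G : functor D E) (F : functor C D)
  (A : C) : fmap G (fmap F (idm A)) = idm (G (F A)).
Proof. by rewrite !fmap1. Qed.

Lemma comp_functor_comp (C D E : category) (G : functor D E) (F : functor C D)
  (X Y Z : C) (g : hom Y Z) (f : hom X Y) :
  fmap G (fmap F (g ∘ f)) = fmap G (fmap F g) ∘ fmap G (fmap F f).
Proof. by rewrite !fmapM. Qed.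

Definition comp_functor (C D E : category) (G : functor D E) (F : functor C D) :
    functor C E :=
  @Functor C E (fun A => G (F A)) (fun _ _ f => fmap G (fmap F f))
    (comp_functor_id G F) (@comp_functor_comp _ _ _ G F).

Definition functor_iso (C D : category) (F G : functor C D) : Prop :=
  exists eta : forall A : C, hom (F A) (G A),
    (forall A, isomorphism (eta A)) /\
    (forall (A B : C) (f : hom A B), fmap G f ∘ eta A = eta B ∘ fmap F f).

Definition full (C D : category) (F : functor C D) : Prop :=
  forall (A B : C) (g : hom (F A) (F B)), exists f : hom A B, fmap F f = g.

Definition faithful (C D : category) (F : functor C D) : Prop :=
  forall A B : C, injective (fun f : hom A B => fmap F f).

Definition autoequivalence (C : category) (F : functor C C) : Prop :=
  full F /\ faithful F /\ (forall B : C, exists A : C, isomorphic B (F A)).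

(* Equality of functors is Leibniz equality: the functor laws are propositions,
   so this is strict equality of the object maps and of the arrow maps. *)
Definition automorphism (C : category) (F : functor C C) : Prop :=
  exists G : functor C C,
    comp_functor G F = id_functor C /\ comp_functor F G = id_functor C.

(* Sets are the types of a fixed universe, the one containing the hom-types. *)
Definition SET : category :=
  @Category Type (fun X Y => X -> Y) (fun _ x => x)
    (fun _ _ _ g f x => g (f x))
    (fun _ _ _ => erefl) (fun _ _ _ => erefl) (fun _ _ _ _ _ _ _ => erefl).

Lemma hom_functor_id (C : category) (W A : C) :
  (fun h : hom W A => idm A ∘ h) = id.
Proof. by apply: functional_extensionality => h; rewrite comp1m. Qed.

Lemma hom_functor_comp (C : category) (W X Y Z : C)
    (g : hom Y Z) (f : hom X Y) :
  (fun h : hom W X => (g ∘ f) ∘ h) = (fun h => g ∘ (f ∘ h)).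
Proof. by apply: functional_extensionality => h; rewrite compA. Qed.

Definition hom_functor (C : category) (W : C) : functor C SET :=
  @Functor C SET (fun A => hom W A) (fun _ _ f h => f ∘ h)
    (hom_functor_id W) (@hom_functor_comp C W).

Definition represented_by (C : category) (Q : functor C SET) (W : C) : Prop :=
  functor_iso Q (hom_functor W).

Definition same_cardinality (X Y : Type) : Prop :=
  exists f : X -> Y, bijective f.

(* [Q C] and [Q A] are equal only propositionally, so [fmap Q s : Q C -> Q B]
   is compared with [u : Q A -> Q B] after transporting its domain along
   [e : Q C = Q A]. *)
Definition unique_lifting (C : category) (Q : functor C SET) : Prop :=
  forall A B : C, same_cardinality (Q A) (Q B) ->
  forall u : Q A -> Q B, bijective u ->
  exists! X : C, exists (s : hom X B) (e : Q X = Q A :> Type),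
    isomorphism s /\
    eq_rect (Q X : Type) (fun S : Type => S -> Q B) (fmap Q s) (Q A) e = u.

(* Main.v *)
Require Import Defs.
From mathcomp Require Import ssreflect ssrfun ssrbool.
From Stdlib Require Import FunctionalExtensionality ProofIrrelevance
  IndefiniteDescription.

(** Both halves rest on one natural family of bijections.  Since [Q] is
    [Hom(W, -)] up to isomorphism, and [pi] is full and faithful, there are
    bijections
    [Q A ~ Hom(W, A) ~ Hom(pi W, pi A) ~ Hom(W, pi A) ~ Q (pi A)],
    the third one being precomposition with an isomorphism [W -> pi W]; all of
    them are natural in [A].  Their composite is [u]
    ([underlying_set_preserved]).

    For the second half, lift each [u A] to an isomorphism
    [s A : P A -> pi A] with [Q (P A) = Q A].  Conjugating [pi] by the [s A]
    gives a functor [phi], isomorphic to [pi], with [phi A = P A]; naturality of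
    [u] says exactly that [phi] is concrete: up to the equalities
    [Q (phi A) = Q A], it does not change underlying maps.

    It remains to see that a concrete autoequivalence is an automorphism.  The
    uniqueness of liftings makes [Q] amnestic: an isomorphism whose underlying
    map is an identity joins two equal objects ([lifting_amnestic]).  If
    [phi A = phi A'], the identity of this object comes from an isomorphism
    [A -> A'] over an identity map, hence [A = A'].  Given [B], pick an
    isomorphism [B -> phi A] and lift its underlying map to [t : X -> A] with
    [Q X = Q B]; then [B -> phi A <- phi X] is an isomorphism over an identity
    map, hence [B = phi X].  So [phi] is bijective on objects, and a full and
    faithful functor with this property has a strict inverse
    ([full_faithful_bijective_automorphism]). *)

Set Implicit Arguments.
Unset Strict Implicit.
Unset Printing Implicit Defensive.
(* [compA] is to be associativity in a category, not that of functions. *)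
Import Defs.
Local Open Scope cat_scope.

(** * Choice, and transport along equalities *)

Lemma forall_exists_choice (I : Type) (T : I -> Type)
    (R : forall i, T i -> Prop) :
  (forall i, exists x, R i x) -> exists f : forall i, T i, forall i, R i (f i).
Proof.
move=> H; exists (fun i =>
  proj1_sig (constructive_indefinite_description _ (H i))).
by move=> i; case: constructive_indefinite_description.
Qed.

Lemma inj_surj_bijective (X Y : Type) (f : X -> Y) :
  injective f -> (forall y, exists x, f x = y) -> bijective f.
Proof.
move=> f_inj /forall_exists_choice [g fg].
by exists g => // x; apply: f_inj; rewrite fg.
Qed.

Definition cast (X Y : Type) (e : X = Y) (x : X) : Y :=
  eq_rect X (fun S : Type => S) x Y e.

Lemma cast_id (X : Type) (e : X = X) x : cast e x = x.
Proof. by rewrite (proof_irrelevance _ e erefl). Qed.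

Lemma cast_trans (X Y Z : Type) (e : X = Y) (e' : Y = Z) x :
  cast e' (cast e x) = cast (etrans e e') x.
Proof. by case: Z / e'. Qed.

Lemma cast_inj (X Y : Type) (e : X = Y) : injective (cast e).
Proof. by case: Y / e => x y. Qed.

Lemma cast_bij (X Y : Type) (e : X = Y) : bijective (cast e).
Proof. by case: Y / e; exists id. Qed.

Lemma eq_rect_domE (X Y T : Type) (e : X = Y) (f : X -> T) (u : Y -> T) :
  eq_rect X (fun S : Type => S -> T) f Y e = u <->
  forall x, f x = u (cast e x).
Proof.
case: Y / e u => u /=; split=> [-> // | fu].
exact: functional_extensionality.
Qed.

(** Equal objects of a category are joined by this isomorphism; it lets
    equations between morphisms with propositionally equal ends be written as
    commuting squares instead of transports. *)
Definition eqm (C : category) (A B : C) (e : A = B) : hom A B :=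
  eq_rect A (hom A) (idm A) B e.

Lemma eqm_id (C : category) (A : C) (e : A = A) : eqm e = idm A.
Proof. by rewrite (proof_irrelevance _ e erefl). Qed.

Lemma eqm_sym_l (C : category) (A B : C) (e : A = B) :
  eqm (esym e) ∘ eqm e = idm A.
Proof. by case: B / e; rewrite comp1m. Qed.

Lemma eqm_sym_r (C : category) (A B : C) (e : A = B) :
  eqm e ∘ eqm (esym e) = idm B.
Proof. by case: B / e; rewrite comp1m. Qed.

Lemma eqm_isomorphism (C : category) (A B : C) (e : A = B) :
  isomorphism (eqm e).
Proof. by exists (eqm (esym e)); rewrite eqm_sym_l eqm_sym_r. Qed.

Lemma fmap_eqm (C D : category) (F : functor C D) (A B : C) (e : A = B) :
  fmap F (eqm e) = eqm (f_equal F e).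
Proof. by case: B / e; rewrite /= fmap1. Qed.

Lemma SET_eqmE (X Y : SET) (e : X = Y) (x : X) :
  (eqm e : X -> Y) x = cast e x.
Proof. by case: Y / e. Qed.

(** * Isomorphisms and functors *)

Lemma isomorphism_comp (C : category) (X Y Z : C) (g : hom Y Z) (f : hom X Y) :
  isomorphism g -> isomorphism f -> isomorphism (g ∘ f).
Proof.
move=> [g' [g'g gg']] [f' [f'f ff']]; exists (f' ∘ g'); split.
  by rewrite compA -(compA f') g'g compm1.
by rewrite compA -(compA g) ff' compm1.
Qed.

Lemma fmap_isomorphism (C D : category) (F : functor C D) (A B : C)
    (f : hom A B) :
  isomorphism f -> isomorphism (fmap F f).
Proof.
by move=> [g [gf fg]]; exists (fmap F g); rewrite -!fmapM gf fg !fmap1.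
Qed.

Lemma full_faithful_reflects_isomorphism (C D : category) (F : functor C D)
    (A B : C) (f : hom A B) :
  full F -> faithful F -> isomorphism (fmap F f) -> isomorphism f.
Proof.
move=> F_full F_faithful [g' [gf fg]].
have [g Fg] := F_full _ _ g'; subst g'; exists g.
by split; apply: F_faithful; rewrite fmapM fmap1.
Qed.

Lemma SET_isomorphism_bijective (X Y : SET) (f : hom X Y) :
  isomorphism f -> bijective (f : X -> Y).
Proof.
move=> [g [gf fg]]; exists g => x.
  exact: (f_equal (fun k : X -> X => k x) gf).
exact: (f_equal (fun k : Y -> Y => k x) fg).
Qed.

Lemma functor_iso_full (C D : category) (F G : functor C D) :
  functor_iso F G -> full F -> full G.
Proof.
move=> [eta [eta_iso eta_nat]] F_full A B g.
have [a [_ etaa]] := eta_iso A; have [b [_ etab]] := eta_iso B.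
have [f Ff] := F_full _ _ (b ∘ g ∘ eta A); exists f.
rewrite -(compm1 (fmap G f)) -etaa compA eta_nat Ff !compA etab comp1m.
by rewrite -compA etaa compm1.
Qed.

Lemma functor_iso_faithful (C D : category) (F G : functor C D) :
  functor_iso F G -> faithful F -> faithful G.
Proof.
move=> [eta [eta_iso eta_nat]] F_faithful A B f g /= Gfg; apply: F_faithful.
have [b [etab _]] := eta_iso B.
by rewrite -[LHS]comp1m -[RHS]comp1m -etab -!compA -!eta_nat Gfg.
Qed.

Lemma functor_iso_sym (C D : category) (F G : functor C D) :
  functor_iso F G -> functor_iso G F.
Proof.
move=> [eta [eta_iso eta_nat]].
have [th thP] := forall_exists_choice eta_iso.
exists th; split=> [A | A B f]; first by exists (eta A); case: (thP A).
have [_ etaA] := thP A; have [thB _] := thP B.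
rewrite -[LHS]comp1m -thB -!compA (compA (eta B)) -eta_nat.
by rewrite -(compA (fmap G f)) etaA compm1.
Qed.

(** Conjugating a functor by an arbitrary family of isomorphisms allows its
    object map to be replaced by any pointwise isomorphic one. *)
Lemma conjugate_functor (C D : category) (F : functor C D) (P : C -> D)
    (s : forall A, hom (P A) (F A)) :
  (forall A, isomorphism (s A)) ->
  exists G : forall A B : C, hom A B -> hom (P A) (P B),
  exists (G1 : forall A, G _ _ (idm A) = idm (P A))
    (GM : forall (X Y Z : C) (g : hom Y Z) (f : hom X Y),
       G _ _ (g ∘ f) = G _ _ g ∘ G _ _ f),
  forall A B (f : hom A B),
    fmap F f ∘ s A = s B ∘ fmap (Functor G1 GM) f.
Proof.
move=> /forall_exists_choice [t tP].
exists (fun A B f => t B ∘ fmap F f ∘ s A).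
have G1 A : t A ∘ fmap F (idm A) ∘ s A = idm (P A).
  by rewrite fmap1 compm1; case: (tP A).
have GM (X Y Z : C) (g : hom Y Z) (f : hom X Y) :
    t Z ∘ fmap F (g ∘ f) ∘ s X =
    (t Z ∘ fmap F g ∘ s Y) ∘ (t Y ∘ fmap F f ∘ s X).
  have [_ st] := tP Y.
  by rewrite fmapM !compA -(compA _ (s Y)) st compm1.
exists G1, GM => A B f /=.
by have [_ st] := tP B; rewrite !compA st comp1m.
Qed.

(** * Strict equality and strict inverses of functors *)

(** The square says that the arrow maps agree up to transport along [e]; once
    the object maps are identified, proof irrelevance turns [eqm (e A)] into an
    identity and identifies the functor laws. *)
Lemma functor_eq (C D : category) (F G : functor C D)
    (e : forall A, F A = G A) :
  (forall A B (f : hom A B), fmap G f ∘ eqm (e A) = eqm (e B) ∘ fmap F f) ->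
  F = G.
Proof.
case: F G e => Fo Fm F1 FM [Go Gm G1 GM] /= e.
have EFG : Fo = Go by apply: functional_extensionality.
case: Go / EFG Gm G1 GM e => Gm G1 GM e FG.
have EFG : Fm = Gm.
  apply: functional_extensionality_dep => A.
  apply: functional_extensionality_dep => B.
  apply: functional_extensionality => f.
  by have := FG _ _ f; rewrite !eqm_id compm1 comp1m.
case: Gm / EFG G1 GM FG => G1 GM _.
by rewrite (proof_irrelevance _ F1 G1) (proof_irrelevance _ FM GM).
Qed.

(** The inverse sends [f : A -> B] to the unique morphism between the chosen
    preimages whose image is [f] up to the equalities [F (g A) = A]. *)
Lemma full_faithful_bijective_automorphism (C : category) (F : functor C C) :
  full F -> faithful F -> bijective (fobj F) -> automorphism F.
Proof.
move=> F_full F_faithful [g Fg gF].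
have GE A B : forall f : hom A B, exists h : hom (g A) (g B),
    fmap F h = eqm (esym (gF B)) ∘ f ∘ eqm (gF A).
  by move=> f; apply: F_full.
pose G A B f : hom (g A) (g B) :=
  proj1_sig (constructive_indefinite_description _ (GE A B f)).
have FG A B (f : hom A B) :
    fmap F (G A B f) = eqm (esym (gF B)) ∘ f ∘ eqm (gF A).
  by rewrite /G; case: constructive_indefinite_description.
have G1 A : G A A (idm A) = idm (g A).
  by apply: F_faithful; rewrite /= FG fmap1 compm1 eqm_sym_l.
have GM (X Y Z : C) (k : hom Y Z) (f : hom X Y) :
    G X Z (k ∘ f) = G Y Z k ∘ G X Y f.
  apply: F_faithful; rewrite /= fmapM !FG !compA.
  by rewrite -(compA _ (eqm (gF Y))) eqm_sym_r compm1.
exists (Functor G1 GM); split.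
  apply: (@functor_eq _ _ (comp_functor (Functor G1 GM) F) (id_functor C)
    Fg) => A B f /=; apply: F_faithful.
  rewrite /= !fmapM FG !fmap_eqm.
  rewrite (proof_irrelevance _ (f_equal F (Fg A)) (gF (F A))).
  rewrite (proof_irrelevance _ (f_equal F (Fg B)) (gF (F B))).
  by rewrite !compA eqm_sym_r comp1m.
apply: (@functor_eq _ _ (comp_functor F (Functor G1 GM)) (id_functor C) gF) => A B f /=.
by rewrite FG !compA eqm_sym_r comp1m.
Qed.

(** * Concrete categories with unique lifting of bijections *)

Section Concrete.
Variables (C : category) (Q : functor C SET).

Lemma fmap_SET_comp (X Y Z : C) (g : hom Y Z) (f : hom X Y) (x : Q X) :
  (fmap Q (g ∘ f) : Q X -> Q Z) x =
  (fmap Q g : Q Y -> Q Z) ((fmap Q f : Q X -> Q Y) x).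
Proof. by rewrite fmapM. Qed.

Lemma lifting_exists (Q_lifting : unique_lifting Q) (A B : C)
    (u : Q A -> Q B) :
  bijective u ->
  exists (X : C) (s : hom X B) (e : Q X = Q A :> Type),
    isomorphism s /\ forall x, (fmap Q s : Q X -> Q B) x = u (cast e x).
Proof.
move=> u_bij.
have AB : same_cardinality (Q A) (Q B) by exists u.
have [X [[s [e [s_iso /eq_rect_domE Qs]]] _]] := Q_lifting A B AB u u_bij.
by exists X, s, e.
Qed.

(** Both [X], through [s], and [A], through its identity, lift the identity map
    of [Q A]. *)
Lemma lifting_amnestic (Q_lifting : unique_lifting Q) (X A : C) (s : hom X A)
    (e : Q X = Q A :> Type) :
  isomorphism s -> (forall x, (fmap Q s : Q X -> Q A) x = cast e x) -> X = A.
Proof.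
move=> s_iso Qs.
have id_bij : bijective (id : Q A -> Q A) by exists id.
have AA : same_cardinality (Q A) (Q A) by exists id.
have [Y [_ Y_uniq]] := Q_lifting A A AA id id_bij.
have <- : Y = X by apply: Y_uniq; exists s, e; split=> //; apply/eq_rect_domE.
apply: Y_uniq; exists (idm A), erefl; split.
  exact: (eqm_isomorphism erefl).
by rewrite /= fmap1.
Qed.

(** [Q \o F] agrees with [Q] strictly; the arrow part is stated on elements,
    because [Q (F A)] and [Q A] are only propositionally equal. *)
Definition concrete (F : functor C C) (e : forall A, Q (F A) = Q A :> Type) :=
  forall (A B : C) (f : hom A B) (x : Q (F A)),
    cast (e B) ((fmap Q (fmap F f) : Q (F A) -> Q (F B)) x) =
    (fmap Q f : Q A -> Q B) (cast (e A) x).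

(** The preimage under [F] of the identity of [F A = F A'] is an isomorphism
    [A -> A'] over an identity map. *)
Lemma concrete_injective_objects (Q_lifting : unique_lifting Q)
    (F : functor C C) (e : forall A, Q (F A) = Q A :> Type) :
  full F -> faithful F -> concrete e -> injective (fobj F).
Proof.
move=> F_full F_faithful Fe A A' E.
have [k Fk] := F_full _ _ (eqm E).
have k_iso : isomorphism k.
  apply: (full_faithful_reflects_isomorphism F_full F_faithful).
  by rewrite Fk; apply: eqm_isomorphism.
pose EQ : Q (F A) = Q (F A') :> Type := f_equal Q E.
apply: (lifting_amnestic Q_lifting (e := etrans (esym (e A)) (etrans EQ (e A')))
  k_iso) => x.
have [c cK Kc] := cast_bij (e A); rewrite -(Kc x) -Fe Fk fmap_eqm SET_eqmE.
by rewrite !cast_trans; congr (cast _ _); apply: proof_irrelevance.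
Qed.

(** An isomorphism [B -> F A] is turned into an equality by correcting [A]:
    [w] is its underlying map seen as a map to [Q A], and the source [X] of a
    lift of [w] satisfies [F X = B]. *)
Lemma concrete_surjective_objects (Q_lifting : unique_lifting Q)
    (F : functor C C) (e : forall A, Q (F A) = Q A :> Type) :
  (forall B, exists A, isomorphic B (F A)) -> concrete e ->
  forall B, exists A, F A = B.
Proof.
move=> F_ess Fe B; have [A [b b_iso]] := F_ess B.
pose w (x : Q B) : Q A := cast (e A) ((fmap Q b : Q B -> Q (F A)) x).
have w_bij : bijective w.
  apply: (bij_comp (cast_bij (e A))).
  by apply: SET_isomorphism_bijective; apply: fmap_isomorphism.
have [X [t [eX [t_iso Qt]]]] := lifting_exists Q_lifting w_bij.
have [r [rt tr]] := fmap_isomorphism F t_iso.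
have r_iso : isomorphism r by exists (fmap F t).
exists X; apply: esym.
apply: (lifting_amnestic Q_lifting (s := r ∘ b)
  (e := etrans (esym eX) (esym (e X)))); first exact: isomorphism_comp.
move=> x; rewrite fmap_SET_comp.
(* [r] undoes [fmap F t], whose underlying map is known since [F] is
   concrete. *)
suff -> : (fmap Q b : Q B -> Q (F A)) x =
    (fmap Q (fmap F t) : Q (F X) -> Q (F A))
      (cast (etrans (esym eX) (esym (e X))) x).
  by rewrite -fmap_SET_comp rt fmap1.
by apply: (@cast_inj _ _ (e A)); rewrite Fe Qt !cast_trans cast_id.
Qed.

Lemma concrete_automorphism (Q_lifting : unique_lifting Q)
    (F : functor C C) (e : forall A, Q (F A) = Q A :> Type) :
  autoequivalence F -> concrete e -> automorphism F.
Proof.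
move=> [F_full [F_faithful F_ess]] Fe.
apply: full_faithful_bijective_automorphism => //; apply: inj_surj_bijective.
  exact: (concrete_injective_objects Q_lifting F_full F_faithful Fe).
exact: (concrete_surjective_objects Q_lifting F_ess Fe).
Qed.

(** The source [P A] of a lift [s A : P A -> F A] of [u A] is the new image of
    [A]; naturality of [u] makes the conjugated arrow map concrete. *)
Lemma isomorphic_concrete_functor (Q_lifting : unique_lifting Q)
    (F : functor C C) (u : forall A : C, Q A -> Q (F A)) :
  (forall A, bijective (u A)) ->
  (forall (A B : C) (f : hom A B), fmap Q (fmap F f) \o u A = u B \o fmap Q f) ->
  exists (G : functor C C) (e : forall A, Q (G A) = Q A :> Type),
    functor_iso G F /\ concrete e.
Proof.
move=> u_bij u_nat.
have /forall_exists_choice [P] := fun A =>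
  lifting_exists Q_lifting (u_bij A).
move=> /forall_exists_choice [s /forall_exists_choice [e sP]].
have s_iso A : isomorphism (s A) by case: (sP A).
have [G [G1 [GM sG]]] := conjugate_functor s_iso.
exists (Functor G1 GM), e; split; first by exists s.
move=> A B f x; apply: (bij_inj (u_bij B)).
have [_ QsA] := sP A; have [_ QsB] := sP B.
rewrite -QsB -fmap_SET_comp -sG fmap_SET_comp QsA.
exact: (f_equal (fun k : Q A -> Q (F B) => k (cast (e A) x)) (u_nat A B f)).
Qed.

(** * Functors preserving a representing object *)

(** Under the representation, an element of [Q A] is a morphism [h : W -> A];
    it is sent to [F h] precomposed with an isomorphism [w : W -> F W].  This is
    natural in [A] because [w] acts on the other side of [F h]. *)
Lemma underlying_set_preserved (W : C) (F : functor C C) :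
  represented_by Q W -> full F -> faithful F -> isomorphic W (F W) ->
  exists u : forall A : C, Q A -> Q (F A),
    (forall A : C, bijective (u A)) /\
    (forall (A B : C) (f : hom A B),
       fmap Q (fmap F f) \o u A = u B \o fmap Q f).
Proof.
move=> Q_rep F_full F_faithful [w [w' [w'w ww']]].
have [eta [eta_iso eta_nat]] := Q_rep.
have [th [th_iso th_nat]] := functor_iso_sym Q_rep.
pose m A (h : hom W A) : hom W (F A) := fmap F h ∘ w.
have m_bij A : bijective (@m A).
  apply: inj_surj_bijective => [h h' hh' | k].
    apply: F_faithful => /=.
    by rewrite -[LHS]compm1 -[RHS]compm1 -ww' !compA -/(m A h) hh'.
  have [h Fh] := F_full _ _ (k ∘ w'); exists h.
  by rewrite /m Fh -compA w'w compm1.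
exists (fun A => (th (F A) : hom W (F A) -> Q (F A)) \o
                 (@m A \o (eta A : Q A -> hom W A))); split=> [A | A B f].
  apply: bij_comp; first exact: SET_isomorphism_bijective (th_iso (F A)).
  exact: bij_comp (m_bij A) (SET_isomorphism_bijective (eta_iso A)).
apply: functional_extensionality => x /=.
have := f_equal (fun k : hom W (F A) -> Q (F B) => k (m A (eta A x)))
  (th_nat _ _ (fmap F f)).
have := f_equal (fun k : Q A -> hom W B => k x) (eta_nat _ _ f).
by rewrite /= => <- ->; rewrite /m fmapM compA.
Qed.

End Concrete.

Theorem theorem5 (C : category) (Q : functor C SET)
  (Q_faithful : faithful Q) (Q_lifting : unique_lifting Q)
  (W : C) (Q_rep : represented_by Q W)
  (pi : functor C C) (pi_autoeq : autoequivalence pi)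
  (pi_W : isomorphic W (pi W)) :
  (exists u : forall A : C, Q A -> Q (pi A),
     (forall A : C, bijective (u A)) /\
     (forall (A B : C) (f : hom A B),
        fmap Q (fmap pi f) \o u A = u B \o fmap Q f)) /\
  (exists phi : functor C C, automorphism phi /\ functor_iso pi phi).
Proof.
have [pi_full [pi_faithful pi_ess]] := pi_autoeq.
have [u [u_bij u_nat]] :=
  underlying_set_preserved Q_rep pi_full pi_faithful pi_W.
split; first by exists u.
have [phi [e [phi_pi phi_e]]] :=
  isomorphic_concrete_functor Q_lifting u_bij u_nat.
have pi_phi := functor_iso_sym phi_pi; exists phi; split=> //.
apply: (concrete_automorphism Q_lifting _ phi_e); split; last split.
- exact: functor_iso_full pi_phi pi_full.
- exact: functor_iso_faithful pi_phi pi_faithful.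
move=> B; have [A [b b_iso]] := pi_ess B.
have [eta [eta_iso _]] := pi_phi.
by exists A, (eta A ∘ b); apply: isomorphism_comp.
Qed.
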